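(* Let $\mathcal A$ be an algebra of subsets of a set $\Omega$ and let $0<p<1$. Suppose that $\phi:\mathcal A\to\mathbb R$ is a normalized supermeasure which satisfies an upper $p$-estimate. Then there is a $\phi$-continuous measure $\lambda$ on $\mathcal A$ such that $\lambda(A)\ge\phi(A)$ for all $A\in\mathcal A$ and $\lambda(\Omega)\le K_p$, where $K_p=\dfrac{2}{(2^p-1)^{1/p}}-1$.
   Context: A set-function $\phi:\mathcal A\to\mathbb R$ is monotone if $\phi(\emptyset)=0$ and $\phi(A)\le\phi(B)$ whenever $A\subset B$, $A,B\in\mathcal A$. It is normalized if $\phi(\Omega)=1$. A monotone set-function $\phi$ is a submeasure if $\phi(A\cup B)\le\phi(A)+\phi(B)$ for all disjoint $A,B\in\mathcal A$, and a supermeasure if $\phi(A\cup B)\ge\phi(A)+\phi(B)$ for all disjoint $A,B\in\mathcal A$. A measure on $\mathcal A$ means a monotone set-function that is both a submeasure and a supermeasure (i.e. a nonnegative, finitely additive set-function). A monotone set-function $\phi$ satisfies an upper $p$-estimate if $\phi^p$ is a submeasure. For monotone set-functions $\lambda,\phi$ on $\mathcal A$, $\lambda$ is $\phi$-continuous if for every sequence $(A_n)$ in $\mathcal A$, $\lim_{n\to\infty}\phi(A_n)=0$ implies $\lim_{n\to\infty}\lambda(A_n)=0$. *)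

(* Defs.v *)
From mathcomp Require Import all_boot all_order all_algebra.
From mathcomp Require Import all_classical all_reals all_analysis.

Set Implicit Arguments.
Unset Strict Implicit.
Unset Printing Implicit Defensive.

Import Order.TTheory GRing.Theory Num.Theory.
Import numFieldNormedType.Exports.

#[global] Open Scope classical_set_scope.
#[global] Open Scope ring_scope.

(* The algebra of sets is the one carried by T : algebraOfSetsType d, its
   members being the A with measurable A.  A real set-function on the algebra
   is a total function set T -> R of which only the values on measurable sets
   are ever constrained or used. *)

Section set_functions.
Context {d : measure_display} {T : algebraOfSetsType d} {R : realType}.
Implicit Types (phi lambda : set T -> R) (p : R).

Definition monotone_setfun phi :=
  phi set0 = 0 /\
  forall A B, measurable A -> measurable B -> A `<=` B -> phi A <= phi B.

Definition normalized phi := phi setT = 1.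

Definition submeasure phi :=
  monotone_setfun phi /\
  forall A B, measurable A -> measurable B -> A `&` B = set0 ->
    phi (A `|` B) <= phi A + phi B.

Definition supermeasure phi :=
  monotone_setfun phi /\
  forall A B, measurable A -> measurable B -> A `&` B = set0 ->
    phi A + phi B <= phi (A `|` B).

(* Finitely additive and real-valued: neither sigma-additivity (as in the
   library's measures) nor the value +oo is involved. *)
Definition fa_measure lambda := submeasure lambda /\ supermeasure lambda.

(* With p != 0 the library's real power satisfies 0 `^ p = 0. *)
Definition upper_estimate p phi :=
  monotone_setfun phi /\ submeasure (fun A => phi A `^ p).

Definition setfun_continuous phi lambda :=
  forall A : nat -> set T, (forall n, measurable (A n)) ->
    phi (A n) @[n --> \oo] --> (0 : R) ->
    lambda (A n) @[n --> \oo] --> (0 : R).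

End set_functions.

Definition Kconst {R : realType} (p : R) : R :=
  2 / ((2 `^ p - 1) `^ p^-1) - 1.

(* Main.v *)
Require Import Defs.
From mathcomp Require Import all_boot all_order all_algebra.
From mathcomp Require Import all_classical all_reals all_analysis.
From mathcomp Require Import ring lra.
Import Order.TTheory GRing.Theory Num.Theory.
Import numFieldNormedType.Exports.

(** Among the finitely additive [lam] that dominate [phi], take one of least
    total mass [L].  Everything follows from what minimality forbids.

    Mass, on a finite algebra.  Given [V] with [lam V > 0], the perturbation
    [(1 + e x) lam - e lam(. `&` V)] would be lighter than [lam] whenever
    [x < lam V / L], so it must fail to dominate for small [e > 0]; hence there
    is a tight set [A] ([phi A = lam A > 0]) at least the proportion
    [lam V / L] of which lies in [V] ([minimal_dominating_tight]).  On a tight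
    set the upper estimate turns into a lower bound: if [U] misses the
    proportion [x] of [A], then
    [phi (A `\` U) >= (1 - (1 - x)^p)^(1/p) lam A] ([tight_remainder]).  Now
    exhaust the space greedily: to a set [U] already chosen, add a tight set a
    proportion [x >= s := lam (~` U) / L] of which lies outside [U].  By the
    supermeasure property [phi U] grows at least by
    [(1 - (1 - x)^p)^(1/p) lam A], while [L s] drops by [x lam A].  Where
    [1 - (1 - x)^p >= C x], the ratio of gain to drop is at least
    [C^(1/p) s^(1/p - 1)], and integrating it over [x0 <= s <= 1] gives
    [L p C^(1/p) (1 - x0^(1/p)) <= phi setT = 1] ([finite_minimal_mass]).
    Concavity of [t^p] offers two choices: the tangent at [x = 0], that is
    [C = p] and [x0 = 0], and the chord through [x = 1/2], that is
    [C = 2 (1 - 2^-p)] and [x0 = 1/2].  The first yields [L <= K_p] when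
    [p >= 1/2], the second when [p <= 1/2]; both comparisons use only
    Bernoulli's inequality.

    Passage to the whole algebra.  A limit along an ultrafilter of additive
    set-functions that eventually dominate [phi] up to any error is additive
    and dominates [phi] ([dominating_limit]).  This gives the existence of
    minimal elements, and it glues the solutions on finite subalgebras into one
    on the whole algebra.

    Continuity.  Let [lam] be minimal on the whole algebra and suppose that
    [phi (A n)] tends to [0] while [lam (A n) >= e] infinitely often.  By the
    upper estimate, removing [A n] from a set hardly changes [phi], so a limit
    of [lam (. `\` A n)] still dominates [phi], with mass at most [L - e]: a
    contradiction ([minimal_dominating_continuous]). *)

Set Implicit Arguments.
Unset Strict Implicit.
Unset Printing Implicit Defensive.

Local Open Scope classical_set_scope.
Local Open Scope ring_scope.

(** * Bernoulli's inequality and the concavity of powers *)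

Section powers.
Context {R : realType}.
Implicit Types x y z p q r t : R.

(** Weighted arithmetic-geometric mean inequality for [x] and [1]: with
    [m = 1 + r (x - 1)], apply [ln z <= z - 1] to [x / m] and to [1 / m] and
    average with weights [r] and [1 - r]. *)
Lemma bernoulli_powR_le r x : 0 <= r <= 1 -> 0 <= x ->
  x `^ r <= 1 + r * (x - 1).
Proof.
move=> /andP[r0 r1]; rewrite le_eqVlt => /predU1P[<-|x0].
  have [->|rn0] := eqVneq r 0; first by rewrite powRr0 mul0r addr0.
  by rewrite powR0//; lra.
have [->|rn1] := eqVneq r 1; first by rewrite powRr1 ?(ltW x0)//; lra.
have m0 : 0 < 1 + r * (x - 1).
  have : 0 <= r * x by rewrite mulr_ge0 // ltW.
  have : r < 1 by rewrite lt_neqAle rn1.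
  nra.
set m := 1 + _ in m0 *.
rewrite -ler_ln ?posrE ?powR_gt0// ln_powR.
have ln_le z : 0 < z -> ln z <= z - 1.
  by move=> z0; have := @le_ln1Dx R (z - 1); rewrite addrCA subrr addr0; apply; lra.
have h1 := ln_le (x / m) (divr_gt0 x0 m0).
have h2 : ln m^-1 <= m^-1 - 1 by apply: ln_le; rewrite invr_gt0.
rewrite ln_div ?posrE// in h1; rewrite lnV ?posrE// in h2.
have h3 : r * (x / m - 1) + (1 - r) * (m^-1 - 1) = 0.
  by rewrite /m; field; exact: lt0r_neq0.
have := ler_wpM2l r0 h1; have := ler_wpM2l (_ : 0 <= 1 - r) h2.
move=> /(_ ltac:(lra)); lra.
Qed.

(** The concave inequality for the exponent [1 / q] at [1 + q (x - 1)], read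
    backwards. *)
Lemma bernoulli_powR_ge q x : 1 <= q -> 0 <= x -> 1 + q * (x - 1) <= x `^ q.
Proof.
move=> q1 x0; have q0 : 0 < q by lra.
have [|h] := leP (1 + q * (x - 1)) 0; first by move/le_trans; apply; exact: powR_ge0.
have qV : 0 <= q^-1 <= 1 by rewrite invr_ge0 ltW//= invf_le1.
have := bernoulli_powR_le qV (ltW h).
have -> : 1 + q^-1 * (1 + q * (x - 1) - 1) = x by field; exact: lt0r_neq0.
move=> /(ge0_ler_powR (ltW q0)); rewrite !nnegrE => /(_ (powR_ge0 _ _) x0).
by rewrite -powRrM mulVf ?lt0r_neq0// powRr1// ltW.
Qed.

(** The convex function [t^q] lies above its tangent at [x]; the slope
    [q x^(q - 1)] is written [q (x^q / x)]. *)
Lemma powR_subr_le q x y : 1 <= q -> 0 < x -> 0 <= y ->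
  x `^ q - y `^ q <= q * (x `^ q / x) * (x - y).
Proof.
move=> q1 x0 y0.
have := bernoulli_powR_ge q1 (divr_ge0 y0 (ltW x0)).
have xq0 : 0 < x `^ q by exact: powR_gt0.
move=> /(ler_wpM2l (ltW xq0)).
rewrite -powRM ?(ltW x0)// ?divr_ge0 ?(ltW x0)// mulrCA divff ?lt0r_neq0// mulr1.
rewrite -subr_ge0 => h; rewrite -subr_ge0; apply: le_trans h _.
by rewrite le_eqVlt; apply/orP; left; apply/eqP; field; exact: lt0r_neq0.
Qed.

(** The point [1/2] lies between [0] and [x], so the concave function
    [(1 - t)^p] is at [1/2] above its chord over [0, x].  Both ends of the chord
    are bounded by the tangent of [t^p] at [1/2]. *)
Lemma powR_chord_half p x : 0 <= p <= 1 -> 2^-1 <= x <= 1 ->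
  2 * x * (1 - 2^-1 `^ p) <= 1 - (1 - x) `^ p.
Proof.
move=> hp /andP[x2 x1].
have h1 := @bernoulli_powR_le p 2 hp ltac:(lra).
have h2 := @bernoulli_powR_le p (2 * (1 - x)) hp ltac:(lra).
have u0 : 0 < 2^-1 `^ p :> R by apply: powR_gt0; lra.
have e1 : 2 `^ p * 2^-1 `^ p = 1 :> R.
  by rewrite -powRM ?divff ?powR1//; lra.
rewrite powRM in h2; [|lra|lra].
have {}h2 := ler_wpM2l (ltW u0) h2.
rewrite mulrA [_ * 2 `^ p]mulrC e1 mul1r in h2.
have {}h1 := ler_wpM2l (ltW u0) h1.
rewrite [_ * 2 `^ p]mulrC e1 in h1.
have : 0 <= 2 * x - 1 by lra.
move=> x0; have := ler_wpM2l x0 h1.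
nra.
Qed.

End powers.

(** * Comparison with the constant [K_p] *)

Section constants.
Context {R : realType}.
Implicit Types L a p : R.

Let half_powR p : 2^-1 `^ p = (2 `^ p)^-1 :> R.
Proof. by rewrite -(powR_inv1 (_ : 0 <= 2))// -powRrM mulN1r powRN. Qed.

Let half_gap_gt0 p : 0 < p -> 0 < 1 - 2^-1 `^ p :> R.
Proof.
move=> p0; rewrite half_powR subr_gt0 invf_lt1 ?powR_gt0//.
by rewrite -[ltLHS](@powRr0 R 2) /powR !gt_eqF// ltr_expR ltr_pM2r// ln_gt0; lra.
Qed.

Lemma KconstE p : 0 < p -> Kconst p = ((1 - 2^-1 `^ p) `^ p^-1)^-1 - 1 :> R.
Proof.
move=> p0; have p_neq0 := lt0r_neq0 p0; rewrite /Kconst; congr (_ - 1).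
have -> : 2 `^ p - 1 = 2 `^ p * (1 - 2^-1 `^ p) :> R.
  by rewrite half_powR mulrBr mulr1 divff// lt0r_neq0// powR_gt0.
rewrite powRM ?powR_ge0 ?ltW ?half_gap_gt0// -powRrM divff// powRr1//.
by rewrite invfM mulrA divff// mul1r.
Qed.

Let le_Kconst p L : 0 < p ->
  L * (1 - 2^-1 `^ p) `^ p^-1 + (1 - 2^-1 `^ p) `^ p^-1 <= 1 -> L <= Kconst p.
Proof.
move=> p0; rewrite KconstE//.
have a0 : 0 < (1 - 2^-1 `^ p) `^ p^-1 by rewrite powR_gt0// half_gap_gt0.
move=> h; rewrite lerBrDr -(ler_pM2r a0) mulVf ?lt0r_neq0//.
by rewrite mulrDl mul1r.
Qed.

(** Writing [a = (1 - 2^-p)^(1/p)], one has [K_p = 1 / a - 1], and the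
    hypothesis reads [L a p (2^(1/p) - 1) <= 1].  For [p <= 1/2] Bernoulli's inequality
    gives [p (2^(1/p) - 1) >= 3/2] and [a <= 1/3], so
    [L a + a <= 2/3 + 1/3 = 1]. *)
Lemma le_Kconst_small p L : 0 < p <= 2^-1 -> 0 <= L ->
  L * (p * (2 * (1 - 2^-1 `^ p)) `^ p^-1 * (1 - 2^-1 `^ p^-1)) <= 1 ->
  L <= Kconst p.
Proof.
move=> /andP[p0 p2] L0; set u := 1 - 2^-1 `^ p.
have u0 : 0 < u by exact: half_gap_gt0.
have q2 : 2 <= p^-1 by rewrite -[2]invrK lef_pV2 ?posrE//; lra.
have u3 : u <= 3^-1.
  have := @bernoulli_powR_le R p 2 ltac:(lra) ltac:(lra).
  have t0 : 0 < 2 `^ p :> R by exact: powR_gt0.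
  rewrite /u half_powR => t1.
  have : (3 / 2)^-1 <= (2 `^ p)^-1 :> R by rewrite lef_pV2 ?posrE//; lra.
  by lra.
have a3 : u `^ p^-1 <= 3^-1.
  by apply: (le_trans _ u3); apply: ge1r_powR; [rewrite u0/=|]; lra.
rewrite powRM ?(ltW u0)//.
have -> : p * (2 `^ p^-1 * u `^ p^-1) * (1 - 2^-1 `^ p^-1) =
          u `^ p^-1 * (p * (2 `^ p^-1 - 1)) :> R.
  have t0 : 2 `^ p^-1 != 0 :> R by rewrite lt0r_neq0// powR_gt0.
  by rewrite half_powR; field.
(* Bernoulli for 4^(q / 2), whose exponent is at least 1, where q = 1 / p. *)
have h2 : 3 / 2 <= p * (2 `^ p^-1 - 1) :> R.
  have := @bernoulli_powR_ge R (p^-1 / 2) 4 ltac:(lra) ltac:(lra).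
  have -> : 4 `^ (p^-1 / 2) = 2 `^ p^-1 :> R.
    have -> : 4 = 2 `^ 2 :> R by rewrite powR_mulrn// -natrX.
    by rewrite -powRrM; congr (_ `^ _); field; exact: lt0r_neq0.
  move=> h; have := ler_wpM2l (ltW p0) h.
  have : p * p^-1 = 1 by rewrite divff// lt0r_neq0.
  by nra.
rewrite mulrA => h; apply: le_Kconst => //; rewrite -/u.
have La0 : 0 <= L * u `^ p^-1 by rewrite mulr_ge0// powR_ge0.
have := ler_wpM2l La0 h2; lra.
Qed.

(** Equality holds at [p = 1/2] and at [p = 1].  With [r = 1/p - 1], which lies
    in [0, 1] on this range, Bernoulli bounds [p^r] from above and
    [(1 + p)^r = 1 / (1 / (1 + p))^r] from below by rational functions of [p];
    what remains is [(1 - p)^2 (2 p - 1) >= 0]. *)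
Lemma powR_invr_ge p : 2^-1 <= p <= 1 -> p^-1 + p `^ p^-1 <= (1 + p) `^ p^-1.
Proof.
move=> /andP[p2 p1]; have p0 : 0 < p by lra.
have pp0 := lt0r_neq0 p0.
pose r := p^-1 - 1.
have rp : r * p = 1 - p by rewrite /r; field.
have q2 : p^-1 <= 2 by rewrite invf_ple ?posrE//; lra.
have q1 : 1 <= p^-1 by rewrite invf_ge1.
have hr : 0 <= r <= 1 by rewrite /r; lra.
have split_pow x : 0 < x -> x `^ p^-1 = x * x `^ r.
  move=> x0; rewrite -[in LHS](subrK 1 p^-1) powRD ?lt0r_neq0 ?implybT//.
  by rewrite powRr1 ?ltW// mulrC.
rewrite !split_pow//; last lra.
have h1 := @bernoulli_powR_le _ r p hr (ltW p0).
have h2 : (1 + p) / (2 * p) <= (1 + p) `^ r.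
  have := @bernoulli_powR_le _ r (1 + p)^-1 hr ltac:(rewrite invr_ge0; lra).
  have w0 : 0 < (1 + p) `^ r by rewrite powR_gt0; lra.
  have -> : (1 + p)^-1 `^ r = ((1 + p) `^ r)^-1.
    by rewrite -(powR_inv1 (_ : 0 <= 1 + p)) -?powRrM ?mulN1r ?powRN//; lra.
  have -> : 1 + r * ((1 + p)^-1 - 1) = ((1 + p) / (2 * p))^-1.
    by rewrite /r; field; rewrite pp0 lt0r_neq0//; lra.
  by rewrite lef_pV2// posrE ?divr_gt0//; lra.
have h3 := ler_wpM2l (ltW p0) h1.
have h4 := ler_wpM2l (_ : 0 <= 1 + p) h2.
have {}h4 := h4 ltac:(lra).
apply: le_trans h4; rewrite -lerBrDr.
apply: (@le_trans _ _ ((1 + p) * ((1 + p) / (2 * p)) - p * (1 + r * (p - 1)))); last lra.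
rewrite -subr_ge0.
have -> : (1 + p) * ((1 + p) / (2 * p)) - p * (1 + r * (p - 1)) - p^-1 =
   (1 - p) ^+ 2 * (2 * p - 1) / (2 * p) by rewrite /r; field.
by rewrite divr_ge0 ?mulr_ge0 ?sqr_ge0//; lra.
Qed.

(** With [a = (1 - 2^-p)^(1/p)] again and [b = p p^(1/p)], it suffices that
    [a <= b / (1 + b)].  From [2^p <= 1 + p] follows
    [a <= p^(1/p) / (1 + p)^(1/p)], and [powR_invr_ge] bounds the denominator
    below by [(1 + b) / p]. *)
Lemma le_Kconst_large p L : 2^-1 <= p <= 1 -> 0 <= L ->
  L * (p * p `^ p^-1) <= 1 -> L <= Kconst p.
Proof.
move=> /andP[p2 p1] L0 h; have p0 : 0 < p by lra.
have pp0 := lt0r_neq0 p0.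
apply: le_Kconst => //; set u := 1 - 2^-1 `^ p.
have u0 : 0 < u by exact: half_gap_gt0.
have up : u <= p / (1 + p).
  have := @bernoulli_powR_le R p 2 ltac:(lra) ltac:(lra).
  have t0 : 0 < 2 `^ p :> R by exact: powR_gt0.
  rewrite /u half_powR => t1.
  have : (1 + p)^-1 <= (2 `^ p)^-1 :> R by rewrite lef_pV2 ?posrE//; lra.
  have -> : p / (1 + p) = 1 - (1 + p)^-1 by field; rewrite lt0r_neq0//; lra.
  by lra.
have w0 : 0 < p `^ p^-1 by exact: powR_gt0.
have aw : u `^ p^-1 * (p^-1 + p `^ p^-1) <= p `^ p^-1.
  apply: (@le_trans _ _ (u `^ p^-1 * (1 + p) `^ p^-1)).
    by rewrite ler_wpM2l ?powR_ge0// powR_invr_ge// p2.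
  rewrite -powRM ?(ltW u0)//; last lra.
  have iq : 0 <= p^-1 by rewrite invr_ge0; lra.
  apply: (ge0_ler_powR iq); rewrite ?nnegrE ?mulr_ge0 ?(ltW u0)//; try lra.
  by rewrite -ler_pdivlMr//; lra.
have a0 : 0 <= u `^ p^-1 by exact: powR_ge0.
have {}aw := ler_wpM2l (ltW p0) aw.
have e : p * (u `^ p^-1 * (p^-1 + p `^ p^-1)) = u `^ p^-1 * (1 + p * p `^ p^-1).
  by field.
rewrite e in aw.
move: (u `^ p^-1) a0 aw => a a0 aw; set b := p * _ in aw h.
have b0 : 0 < b by rewrite mulr_gt0.
nra.
Qed.

End constants.

(** * Dominating additive set-functions *)

Lemma ultra_bounded_cvg {R : realType} {I : Type} (U : set_system I)
    (f : I -> R) a b :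
  UltraFilter U -> (\forall i \near U, a <= f i <= b) ->
  exists l : R, f i @[i --> U] --> l.
Proof.
move=> UU fab.
have Fab : fmap f U `[a, b]%classic.
  by apply: filterS fab => i /=; rewrite in_itv.
have [l [_ Ul]] := @segment_compact R a b (fmap f U) _ Fab.
exists l => N Nl; have [//|UN] := in_ultra_setVsetC (f @^-1` N) UU.
by have [x [nx /nx]] := Ul (~` N) N UN Nl.
Qed.

Section domination.
Context {d : measure_display} {T : algebraOfSetsType d} {R : realType}.
Implicit Types (G : set (set T)) (phi lam mu : set T -> R) (A B : set T).

Definition set_algebra G := setring G /\ G setT.

Definition additive_on G lam :=
  forall A B, G A -> G B -> A `&` B = set0 -> lam (A `|` B) = lam A + lam B.

Definition dominates phi G lam :=
  additive_on G lam /\ forall A, G A -> phi A <= lam A.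

Lemma set_algebraC G A : set_algebra G -> G A -> G (~` A).
Proof. by move=> [[_ _ GD] GT] GA; rewrite -setTD; exact: GD. Qed.

Lemma set_algebraI G A B : set_algebra G -> G A -> G B -> G (A `&` B).
Proof.
move=> aG GA GB; have [[_ _ GD] _] := aG.
by rewrite -[B]setCK -setDE; apply: GD => //; exact: set_algebraC.
Qed.

Lemma set_algebra_measurable : set_algebra (@measurable d T).
Proof.
split; last exact: measurableT.
by split; [exact: measurable0|exact: measurableU|exact: measurableD].
Qed.

Section additive.
Variables (G : set (set T)) (lam : set T -> R).
Hypotheses (aG : set_algebra G) (alam : additive_on G lam).

Lemma additive_on0 : lam set0 = 0.
Proof.
have G0 : G set0 by case: aG => -[].
have := alam G0 G0 (setI0 _); rewrite setU0 => /eqP.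
by rewrite -subr_eq0 opprD addrA subrr sub0r oppr_eq0 => /eqP.
Qed.

Lemma additive_onID A B : G A -> G B -> lam A = lam (A `\` B) + lam (A `&` B).
Proof.
move=> GA GB; rewrite -alam ?setUIDK ?setDE//.
- by rewrite -setIUr setUC setUv setIT.
- by apply: set_algebraI => //; exact: set_algebraC.
- exact: set_algebraI.
- by rewrite setIACA setICl setI0.
Qed.

Lemma additive_on_restrict B : G B -> additive_on G (fun A => lam (A `&` B)).
Proof.
move=> GB A A' GA GA' AA'; rewrite setIUl alam//; [exact: set_algebraI..|].
by rewrite setIACA AA' set0I.
Qed.

End additive.

(** The compactness principle.  Additivity on the complement turns the lower
    bounds [phi] and the bound [M] on the mass into two-sided bounds for each
    value, so that all values converge along an ultrafilter refining [F]. *)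
Lemma dominating_limit (I : Type) (F : set_system I) (m : I -> set T -> R)
    G phi M : ProperFilter F -> set_algebra G ->
  (forall A B, G A -> G B -> A `&` B = set0 ->
     \forall i \near F, m i (A `|` B) = m i A + m i B) ->
  (forall A e, G A -> 0 < e -> \forall i \near F, phi A - e <= m i A) ->
  (forall e, 0 < e -> \forall i \near F, m i setT <= M + e) ->
  exists2 lam, dominates phi G lam & lam setT <= M.
Proof.
move=> FF aG madd mphi mM.
have [U [UU FU]] := ultraFilterLemma FF.
have GT : G setT by case: aG.
have cvgm A : exists l : R, G A -> m i A @[i --> U] --> l.
  have [GA|nGA] := pselect (G A); last by exists 0.
  have GCA := set_algebraC aG GA.
  suff [l] : exists l : R, m i A @[i --> U] --> l by exists l.
  apply: (@ultra_bounded_cvg _ _ _ _ (phi A - 1) (M + 2 - phi (~` A)) UU).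
  apply: FU; near=> i; apply/andP; split.
    by near: i; exact: mphi.
  have : m i (A `|` ~` A) = m i A + m i (~` A).
    by near: i; apply: madd => //; rewrite setICr.
  have : phi (~` A) - 1 <= m i (~` A) by near: i; exact: mphi.
  have : m i setT <= M + 1 by near: i; exact: mM.
  by rewrite setUv; lra.
have {cvgm} [lam lamP] := choice cvgm.
exists lam; first split.
- move=> A B GA GB AB.
  have GAB : G (A `|` B) by case: aG => -[_ + _] _; exact.
  apply: (@cvg_unique _ _ (m i (A `|` B) @[i --> U])) => //; first exact: lamP.
  apply: cvg_trans (cvgD (lamP _ GA) (lamP _ GB)).
  by apply: near_eq_cvg; apply: FU; near=> i; apply/esym; near: i; exact: madd.
- move=> A GA; apply/ler_addgt0Pr => e e0; rewrite -lerBlDr.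
  by apply: (cvgr_to_ge (lamP _ GA)); apply: FU; exact: mphi.
- apply/ler_addgt0Pr => e e0.
  by apply: (cvgr_to_le (lamP _ GT)); apply: FU; exact: mM.
Unshelve. all: by end_near. Qed.

Definition minimal_dominating phi G lam :=
  dominates phi G lam /\
  forall lam', dominates phi G lam' -> lam setT <= lam' setT.

(** A minimizing sequence has an ultrafilter limit. *)
Lemma minimal_dominating_exists G phi lam0 :
  set_algebra G -> dominates phi G lam0 ->
  exists lam, minimal_dominating phi G lam.
Proof.
move=> aG dom0; have GT : G setT by case: aG.
pose S := [set lam setT | lam in dominates phi G].
have S0 : S !=set0 by exists (lam0 setT), lam0.
have Slb : has_lbound S by exists (phi setT) => _ [mu [_ + ] <-]; exact.
have near_inf n : exists mu, dominates phi G mu /\ mu setT <= inf S + n.+1%:R^-1.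
  have [|_ [mu dmu <-] /ltW mu_lt] := @inf_adherent _ S n.+1%:R^-1 _ (conj S0 Slb).
    by rewrite invr_gt0 ltr0n.
  by exists mu.
have [m mP] := choice near_inf.
have [|||lam dlam lam_inf] := @dominating_limit nat \oo m G phi (inf S) _ aG.
- by move=> A B GA GB AB; near=> n; apply: (mP n).1.1.
- move=> A e GA e0; near=> n; have := (mP n).1.2 A GA; lra.
- move=> e e0; near=> n; apply: le_trans (mP n).2 _; rewrite lerD2l; apply/ltW.
  by near: n; exact: near_infty_natSinv_lt (PosNum e0).
exists lam; split=> // mu dmu; apply: le_trans lam_inf _.
by apply: ge_inf => //; exists mu.
Unshelve. all: by end_near. Qed.

End domination.

(** * The mass of a minimal solution on a finite algebra *)

Lemma finite_set_argmin {R : realType} {X : Type} (S : set X) (f : X -> R) :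
  finite_set S -> S !=set0 -> exists2 x, S x & forall y, S y -> f x <= f y.
Proof.
move=> finS [x0 Sx0].
have /finite_seqP[s sE] : finite_set (f @` S) by exact: finite_image.
have s0 : f x0 \in s.
  by have : (f @` S) (f x0); [exists x0|rewrite sE].
have [i [/= ilt imin]] : exists i, (i < size s)%N /\
    forall j, (j < size s)%N -> s`_i <= s`_j.
  have s_gt0 : (0 < size s)%N by case: s s0 {sE}.
  have [i _ imin] := arg_minP (fun i : 'I_(size s) => s`_i) (erefl : xpredT (Ordinal s_gt0)).
  by exists i; split=> // j jlt; exact: (imin (Ordinal jlt)).
have [x Sx fx] : (f @` S) s`_i by rewrite sE /=; exact: mem_nth.
exists x => // y Sy; rewrite fx.
have : (f @` S) (f y) by exists y.
by rewrite sE /= => /(nthP 0)[j jlt <-]; exact: imin.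
Qed.

Section tight.
Context {d : measure_display} {T : algebraOfSetsType d} {R : realType}.
Variables (G : set (set T)) (phi lam : set T -> R).
Hypotheses (aG : set_algebra G) (finG : finite_set G).
Hypothesis phi_ge0 : forall A, G A -> 0 <= phi A.
Hypothesis lam_min : minimal_dominating phi G lam.

(** Otherwise some [x < lam V / lam setT] bounds the proportion
    [lam (A `&` V) / lam A] on every tight [A], finiteness providing a largest
    one.  Then [mu = (1 + e x) lam - e lam(. `&` V)] still dominates [phi]: on
    tight sets by the choice of [x], and on the others, where
    [phi A < lam A], once [e] is small, again by finiteness.  But its mass is
    [lam setT + e (x lam setT - lam V) < lam setT]. *)
Lemma minimal_dominating_tight V : G V -> 0 < lam V ->
  exists A, [/\ G A, phi A = lam A, 0 < lam A
              & lam V * lam A <= lam (A `&` V) * lam setT].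
Proof.
move=> GV V0; apply: contrapT => notight.
have [[lamadd lamge] lammin] := lam_min.
have lam_ge0 A : G A -> 0 <= lam A.
  by move=> GA; apply: le_trans (phi_ge0 GA) (lamge _ GA).
have lamI A : G A -> 0 <= lam (A `&` V) <= lam A.
  move=> GA; have GAV := set_algebraI aG GA GV.
  rewrite lam_ge0//= (additive_onID aG lamadd GA GV) lerDr lam_ge0//.
  by case: aG => -[_ _ +] _; apply.
have GT : G setT by case: aG.
have L0 : 0 < lam setT.
  by apply: lt_le_trans V0 _; have /andP[_] := lamI _ GT; rewrite setTI.
have [x [x0 xL xP]] : exists x, [/\ 0 <= x, x * lam setT < lam V &
    forall A, G A -> phi A = lam A -> lam (A `&` V) <= x * lam A].
  pose S := [set A | [/\ G A, phi A = lam A & 0 < lam A]].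
  have finS : finite_set S by apply: sub_finite_set finG => A [].
  have outS A : G A -> phi A = lam A -> ~ S A -> lam (A `&` V) = 0 /\ lam A = 0.
    move=> GA tA nSA; have lA0 : lam A = 0.
      apply/eqP; rewrite eq_le lam_ge0// andbT leNgt; apply/negP => lA.
      by apply: nSA.
    by have := lamI _ GA; rewrite lA0 => ?; split=> //; apply/eqP; rewrite eq_le andbC.
  have [[A0 SA0]|S0] := pselect (S !=set0).
    have [|A [GA tA lA] Amax] := @finite_set_argmin R _ S
      (fun A => - (lam (A `&` V) / lam A)) finS; first by exists A0.
    exists (lam (A `&` V) / lam A); split.
    - by rewrite divr_ge0// lam_ge0//; exact: set_algebraI.
    - rewrite -(ltr_pM2r lA) mulrAC divfK ?lt0r_neq0// ltNge; apply/negP => le.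
      by apply: notight; exists A.
    - move=> B GB tB; have [SB|nSB] := pselect (S B).
        have [_ _ lB] := SB; rewrite -ler_pdivrMr//.
        by have := Amax _ SB; rewrite lerN2.
      by have [-> ->] := outS _ GB tB nSB; rewrite mulr0.
  exists 0; split; rewrite ?mul0r// => B GB tB.
  by have [|-> ->] := outS _ GB tB; rewrite ?mul0r// => SB; apply: S0; exists B.
have [e [e0 eP]] : exists e, 0 < e /\
    forall A, G A -> phi A != lam A -> e * lam A <= lam A - phi A.
  pose S := [set A | G A /\ phi A < lam A].
  have finS : finite_set S by apply: sub_finite_set finG => A [].
  have inS A : G A -> phi A != lam A -> S A.
    by move=> GA nA; split=> //; rewrite lt_neqAle nA lamge.
  have [[A0 SA0]|S0] := pselect (S !=set0); last first.
    by exists 1; split=> // A GA nA; case: S0; exists A; exact: inS.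
  have [|A [GA tA] Amin] := @finite_set_argmin R _ S
    (fun A => (lam A - phi A) / lam A) finS; first by exists A0.
  have S_gt0 B : S B -> 0 < lam B by move=> [GB]; apply: le_lt_trans; exact: phi_ge0.
  exists ((lam A - phi A) / lam A); split.
    by rewrite divr_gt0 ?subr_gt0// S_gt0.
  by move=> B GB nB; rewrite -ler_pdivlMr ?S_gt0 ?Amin//; exact: inS.
pose mu A := (1 + e * x) * lam A - e * lam (A `&` V).
have dmu : dominates phi G mu.
  split=> [A B GA GB AB|A GA].
    rewrite /mu (additive_on_restrict aG lamadd GV)// lamadd//; lra.
  have /andP[AV0 AV] := lamI _ GA.
  have [tA|nA] := eqVneq (phi A) (lam A).
    have := xP _ GA tA; rewrite tA /mu -(ler_pM2l e0); lra.
  have := eP _ GA nA; have := ler_wpM2l (ltW e0) AV.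
  have : 0 <= e * x * lam A by rewrite !mulr_ge0 ?lam_ge0 ?(ltW e0).
  by rewrite /mu; lra.
have := lammin _ dmu; apply/negP; rewrite -ltNge /mu setTI.
by move: xL; rewrite -(ltr_pM2l e0); lra.
Qed.

End tight.

Section finite_mass.
Context {d : measure_display} {T : algebraOfSetsType d} {R : realType}.
Variables (G : set (set T)) (phi lam : set T -> R) (p : R).
Hypotheses (aG : set_algebra G) (finG : finite_set G).
Hypothesis (GT : G `<=` measurable).
Hypotheses (p0 : 0 < p) (p1 : p < 1).
Hypotheses (phi_norm : normalized phi) (phi_super : supermeasure phi).
Hypothesis phi_upper : upper_estimate p phi.
Hypothesis lam_min : minimal_dominating phi G lam.

Let phi_ge0 A : G A -> 0 <= phi A.
Proof.
move=> /GT mA; have [<- phi_le] := phi_super.1.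
by apply: phi_le => //; exact: measurable0.
Qed.

Let powR_div_le (q x y : R) : 1 <= q -> 0 < x -> x <= y -> x `^ q / x <= y `^ q / y.
Proof.
move=> q1 x0 xy; have y0 := lt_le_trans x0 xy.
have e z : 0 < z -> z `^ q / z = z `^ (q - 1).
  move=> z0; rewrite -(@mulr_powRB1 _ z q) ?(ltW z0)//; last lra.
  by rewrite mulrAC divff ?lt0r_neq0// mul1r.
by rewrite !e//; apply: ge0_ler_powR; rewrite ?nnegrE; lra.
Qed.

(** The upper estimate for [A] split by [U], read as a lower bound on the part
    outside [U]: tightness gives [phi A = lam A], and domination bounds
    [phi (A `&` U)] by the [lam]-mass of at most [(1 - x) lam A]. *)
Lemma tight_remainder A U C x : G A -> G U -> phi A = lam A -> 0 <= C ->
  0 <= x <= 1 ->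
  lam (A `&` U) <= (1 - x) * lam A -> C * x <= 1 - (1 - x) `^ p ->
  C `^ p^-1 * x `^ p^-1 * lam A <= phi (A `\` U).
Proof.
move=> GA GU tA C0 /andP[x0 x1] lAU Cx.
have [[_ _ GD] _] := aG.
have GAU := set_algebraI aG GA GU.
have GAD := GD _ _ GA GU.
have lA0 : 0 <= lam A by rewrite -tA phi_ge0.
have [_ [_ phi_p]] := phi_upper.
have := phi_p (A `\` U) (A `&` U) (GT GAD) (GT GAU).
rewrite setDE setIACA setICl setI0 -setIUr setUC setUv setIT -setDE.
move=> /(_ erefl) h.
have h2 : phi (A `&` U) `^ p <= ((1 - x) * lam A) `^ p.
  apply: (ge0_ler_powR (ltW p0)); rewrite ?nnegrE ?phi_ge0 ?mulr_ge0//; first lra.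
  by apply: le_trans lAU; case: lam_min => -[_ +] _; exact.
rewrite powRM// in h2; last lra.
have h3 : C * x * lam A `^ p <= phi (A `\` U) `^ p.
  by have := ler_wpM2r (powR_ge0 (lam A) p) Cx; rewrite -tA in h h2 *; lra.
have iq : 0 <= p^-1 by rewrite invr_ge0 ltW.
have := ge0_ler_powR iq _ _ h3; rewrite !nnegrE powR_ge0 !mulr_ge0 ?powR_ge0//.
move=> /(_ isT isT); rewrite !powRM ?mulr_ge0 ?powR_ge0// -!powRrM divff ?lt0r_neq0//.
by rewrite !powRr1// phi_ge0.
Qed.

(** Let [q = 1/p], [L = lam setT], [k = p C^q] and [s U = lam (~` U) / L].  The
    greedy exhaustion never decreases [phi U + L k (s U)^q], which starts at
    [L k]; here [k s^q] is the antiderivative of the ratio [C^q s^(q - 1)] of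
    gain to drop.  By finiteness, some [U] at which the quantity is at least
    [L k] has least [s U].  If [s U <= x0], then [phi U <= 1] gives the bound;
    otherwise adding one more tight set would make [s] smaller. *)
Lemma finite_minimal_mass (C x0 : R) : 0 <= C -> 0 <= x0 ->
  (forall x : R, x0 <= x <= 1 -> C * x <= 1 - (1 - x) `^ p) ->
  lam setT * (p * C `^ p^-1 * (1 - x0 `^ p^-1)) <= 1.
Proof.
move=> C0 x00 Cx.
have [[lamadd lamge] _] := lam_min.
have [[G0 GU GD] GsT] := aG.
have lam_ge0 A : G A -> 0 <= lam A.
  by move=> GA; apply: le_trans (phi_ge0 GA) (lamge _ GA).
have L0 : 0 < lam setT.
  by apply: lt_le_trans (lamge _ GsT); rewrite phi_norm.
have iq : 0 <= p^-1 by rewrite invr_ge0 ltW.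
have q1 : 1 <= p^-1 by rewrite invf_ge1// ltW.
set L := lam setT in L0 *; set q := p^-1 in iq q1 *.
pose k := p * C `^ q.
have k0 : 0 <= k by rewrite mulr_ge0 ?powR_ge0// ltW.
pose s U := lam (~` U) / L.
pose D := [set U | G U /\ L * k <= phi U + L * k * s U `^ q].
have D0 : D set0.
  by split=> //; rewrite /s setC0 divff ?lt0r_neq0// powR1 mulr1 lerDr phi_ge0.
have finD : finite_set D by apply: sub_finite_set finG => A [].
have [|U [GsU UD] Umin] := finite_set_argmin s finD; first by exists set0.
have GCU := set_algebraC aG GsU.
have s0 : 0 <= s U by rewrite divr_ge0 ?lam_ge0// ltW.
have [sx|xs] := leP (s U) x0.
  have : phi U <= 1 by rewrite -phi_norm; apply: phi_super.1.2 => //; exact: GT.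
  have h : s U `^ q <= x0 `^ q by apply: ge0_ler_powR; rewrite ?nnegrE.
  have := ler_wpM2l (mulr_ge0 (ltW L0) k0) h.
  by rewrite -/k; move: UD; lra.
have CU0 : 0 < lam (~` U).
  by rewrite -(pmulr_lgt0 _ (_ : 0 < L^-1)) ?invr_gt0//; apply: le_lt_trans xs.
have [A [GA tA lA lAV]] := minimal_dominating_tight aG finG phi_ge0 lam_min GCU CU0.
set x := lam (A `&` ~` U) / lam A.
have lAE := additive_onID aG lamadd GA GsU.
rewrite setDE in lAE.
have lACU : lam (A `&` ~` U) = x * lam A by rewrite divfK// lt0r_neq0.
have GACU := set_algebraI aG GA GCU.
have xge : s U <= x by rewrite ler_pdivrMr// mulrAC ler_pdivlMr.
have x1 : x <= 1.
  by rewrite ler_pdivrMr// mul1r [leRHS]lAE lerDl lam_ge0//; exact: set_algebraI.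
have xgt0 : 0 < x by lra.
(* The gain in phi; it is compared below with the drop x * lam A / L of s. *)
have rem : C `^ q * x `^ q * lam A <= phi (A `\` U).
  apply: tight_remainder => //; [lra|lra|apply: Cx; lra].
have sE : s (U `|` A) = s U - x * lam A / L.
  rewrite /s -mulrBl; congr (_ / L); rewrite setCU.
  have := additive_onID aG lamadd GCU GA; rewrite setDE [~` U `&` A]setIC lACU.
  by move=> ->; rewrite addrK.
have xl : 0 < x * lam A / L by rewrite divr_gt0// mulr_gt0.
have GUA : G (U `|` A) by exact: GU.
have s'0 : 0 <= s (U `|` A).
  by rewrite divr_ge0 ?(ltW L0)// lam_ge0//; exact: set_algebraC.
suff /Umin : D (U `|` A) by rewrite sE; lra.
split=> //.
have phiUA : phi U + phi (A `\` U) <= phi (U `|` A).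
  have := phi_super.2 U (A `\` U) (GT GsU) (GT (GD _ _ GA GsU)).
  rewrite setDIK => /(_ erefl).
  suff -> : U `|` (A `\` U) = U `|` A by [].
  by rewrite setDE setUIr setUv setIT.
apply: le_trans UD _; apply: le_trans (lerD phiUA (lexx _)).
rewrite -addrA lerD2l -lerBlDr -mulrBr; apply: le_trans rem.
have sgt0 : 0 < s U by lra.
(* Convexity bounds the drop of s^q by its slope at the upper end s U, and the
   slope increases up to x. *)
have := powR_subr_le q1 sgt0 s'0.
have -> : s U - s (U `|` A) = x * lam A / L by rewrite sE; lra.
move=> /(ler_wpM2l (mulr_ge0 (ltW L0) k0)) /le_trans; apply.
have := powR_div_le q1 sgt0 xge.
have Cl : 0 <= C `^ q * x * lam A.
  by rewrite mulr_ge0 ?(ltW lA)// mulr_ge0 ?powR_ge0 ?(ltW xgt0).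
move=> /(ler_wpM2l Cl) h.
have e1 : C `^ q * x `^ q * lam A = C `^ q * x * lam A * (x `^ q / x).
  by field; exact: lt0r_neq0.
rewrite e1; apply: le_trans h; rewrite le_eqVlt; apply/orP; left; apply/eqP.
by rewrite /k /q; field; rewrite !lt0r_neq0.
Qed.

End finite_mass.

(** * Passage from finite subalgebras to the whole algebra *)

Section level_algebra.
Context {T : Type}.
Implicit Types f g : T -> nat.

(** Finite subalgebras are indexed by bounded functions [g : T -> nat]: the
    algebra of [g] consists of the sets that are unions of level sets of [g].
    Level sets themselves may fail to be measurable, so the set algebra will
    retain only the measurable unions. *)
Definition nat_bounded g := exists N, forall x, (g x < N)%N.

Definition refines g f := forall x y, g x = g y -> f x = f y.

Definition saturated g (A : set T) := forall x y, g x = g y -> A x -> A y.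

Lemma finite_saturated g : nat_bounded g -> finite_set (saturated g).
Proof.
move=> [N gN].
apply: (@sub_finite_set _ _
    ((fun S : {set 'I_N} => [set x | Ordinal (gN x) \in S]) @` setT)); last first.
  by apply: finite_image; exact: finite_finset.
move=> A satA; exists [set i : 'I_N | `[< exists2 x, A x & g x = i >]]%SET => //.
apply/seteqP; split=> x /=; rewrite inE.
  by move=> /asboolP[y Ay gy]; exact: satA Ay.
by move=> Ax; apply/asboolP; exists x.
Qed.

(** The pair [(f x, g x)], coded as one integer when [g] is bounded by [N]. *)
Definition common_refinement N f g x := (f x * N + g x)%N.

Lemma common_refinementP N f g : nat_bounded f -> (forall x, (g x < N)%N) ->
  [/\ nat_bounded (common_refinement N f g),
      refines (common_refinement N f g) f & refines (common_refinement N f g) g].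
Proof.
move=> [M fM] gN.
have eqfg x y : common_refinement N f g x = common_refinement N f g y ->
    f x = f y /\ g x = g y.
  have N0 : (0 < N)%N by apply: leq_ltn_trans (gN x).
  rewrite /common_refinement => e.
  have /= := congr1 (divn^~ N) e; rewrite !divnMDl// !divn_small// !addn0.
  by move=> ef; split=> //; move/eqP: e; rewrite ef eqn_add2l => /eqP.
split; [|by move=> x y /eqfg[]..].
exists (M * N)%N => x; rewrite /common_refinement.
apply: (@leq_trans ((f x).+1 * N)); last by rewrite leq_mul2r fM orbT.
by rewrite mulSn addnC ltn_add2r.
Qed.

Definition refinement_filter : set_system (T -> nat) :=
  filter_from nat_bounded (fun f => [set g | nat_bounded g /\ refines g f]).

Lemma refinement_filter_proper : ProperFilter refinement_filter.
Proof.
apply: filter_from_proper; last by move=> f bf; exists f; split.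
apply: filter_from_filter; first by exists (fun=> 0%N), 1%N.
move=> f g bf [N gN]; have [bfg rf rg] := common_refinementP bf gN.
exists (common_refinement N f g) => // h [bh rh].
by split; split=> // x y /rh; [exact: rf|exact: rg].
Qed.

Definition indicator_nat (A : set T) x := nat_of_bool `[< A x >].

Lemma indicator_nat_bounded A : nat_bounded (indicator_nat A).
Proof. by exists 2 => x; rewrite /indicator_nat; case: asboolP. Qed.

Lemma saturated_refines g A : refines g (indicator_nat A) -> saturated g A.
Proof.
move=> rgA x y /rgA; rewrite /indicator_nat => + Ax.
by rewrite asboolT//; case: asboolP.
Qed.

End level_algebra.

Section existence.
Context {d : measure_display} {T : algebraOfSetsType d} {R : realType}.
Variables (phi : set T -> R) (p : R).
Hypotheses (p0 : 0 < p) (p1 : p < 1).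
Hypotheses (phi_norm : normalized phi) (phi_super : supermeasure phi).
Hypothesis phi_upper : upper_estimate p phi.

Definition level_algebra (g : T -> nat) := [set A | measurable A /\ saturated g A].

Lemma level_algebraP g : set_algebra (level_algebra g).
Proof.
split; last by split=> //; exact: measurableT.
split.
- by split; [exact: measurable0|].
- move=> A B [mA sA] [mB sB]; split; first exact: measurableU.
  by move=> x y e [/(sA _ _ e)|/(sB _ _ e)]; [left|right].
- move=> A B [mA sA] [mB sB]; split; first exact: measurableD.
  move=> x y e [Ax nBx]; split; first exact: sA Ax.
  by move=> By; apply: nBx; exact: sB By.
Qed.

Lemma level_algebra_finite g : nat_bounded g -> finite_set (level_algebra g).
Proof. by move=> /finite_saturated; apply: sub_finite_set => A []. Qed.

(** The number of levels that a set meets is additive on the algebra, and it is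
    at least [1 >= phi A] on each nonempty [A]. *)
Lemma level_algebra_dominated g : nat_bounded g ->
  exists lam, dominates phi (level_algebra g) lam.
Proof.
move=> [N gN].
pose has_level (A : set T) k := `[< exists2 x, A x & g x = k >].
exists (fun A => \sum_(k < N) (has_level A k)%:R); split.
  move=> A B [_ sA] [_ sB] AB; rewrite -big_split/=; apply: eq_bigr => k _.
  rewrite -natrD; congr (_%:R); rewrite /has_level.
  have [[x Ax gx]|nA] := asboolP (exists2 x, A x & g x = k).
    rewrite asboolT; last by exists x => //; left.
    rewrite asboolF// => -[y By gy].
    suff : (A `&` B) y by rewrite AB.
    by split=> //; apply: sA Ax; rewrite gx gy.
  rewrite add0n; congr (nat_of_bool _); apply: asbool_equiv_eq; split.
    by move=> [x [Ax|Bx] gx]; [case: nA|]; exists x.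
  by move=> [x Bx gx]; exists x => //; right.
move=> A [mA sA].
have [->|/set0P[x Ax]] := eqVneq A set0.
  by rewrite phi_super.1.1 sumr_ge0.
apply: (@le_trans _ _ 1).
  by rewrite -phi_norm; apply: phi_super.1.2.
rewrite (bigD1 (Ordinal (gN x)))//= [has_level _ _]asboolT; last by exists x.
by rewrite lerDl sumr_ge0.
Qed.

Lemma finite_minimal_mass_le_Kconst G lam : set_algebra G -> finite_set G ->
  G `<=` measurable -> minimal_dominating phi G lam -> lam setT <= Kconst p.
Proof.
move=> aG finG Gm lam_min; have GT : G setT by case: aG.
have L0 : 0 <= lam setT.
  by apply: le_trans (lam_min.1.2 _ GT); rewrite phi_norm.
have mass := finite_minimal_mass aG finG Gm p0 p1 phi_norm phi_super phi_upper lam_min.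
have hp : 0 <= p <= 1 by rewrite (ltW p0) (ltW p1).
have [p2|p2] := leP p 2^-1.
  apply: le_Kconst_small; rewrite ?p0//.
  apply: mass => [||x hx]; rewrite ?invr_ge0//.
    have := @bernoulli_powR_le R p 2^-1 hp ltac:(lra); lra.
  by rewrite mulrAC; exact: powR_chord_half.
apply: le_Kconst_large; rewrite ?(ltW p1) ?(ltW p2)//.
have := mass p 0 (ltW p0) (lexx _).
rewrite powR0 ?subr0 ?mulr1 ?invr_eq0 ?lt0r_neq0//; apply=> x /andP[x0 x1].
have : 0 <= 1 - x by rewrite subr_ge0.
by move=> /(bernoulli_powR_le hp); lra.
Qed.

(** Every measurable set belongs to the algebra of [g] as soon as [g] refines
    its indicator, so the least-mass solutions on these finite algebras have a
    limit along the filter of refinements. *)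
Lemma dominating_measurable :
  exists2 lam, dominates phi measurable lam & lam setT <= Kconst p.
Proof.
have level g : exists lam, nat_bounded g ->
    dominates phi (level_algebra g) lam /\ lam setT <= Kconst p.
  have [bg|nbg] := pselect (nat_bounded g); last by exists phi.
  have aG := level_algebraP g.
  have [lam0 /(minimal_dominating_exists aG)[lam lam_min]] := level_algebra_dominated bg.
  exists lam => _; split; first by case: lam_min.
  apply: (finite_minimal_mass_le_Kconst aG) => //; first exact: level_algebra_finite.
  by move=> A [].
have {level} [m mP] := choice level.
have levelA A : measurable A ->
    \forall g \near refinement_filter, nat_bounded g /\ level_algebra g A.
  move=> mA; exists (indicator_nat A); first exact: indicator_nat_bounded.
  by move=> g [bg rg]; split=> //; split=> //; exact: saturated_refines.
have FF := @refinement_filter_proper T.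
apply: (@dominating_limit _ _ _ _ refinement_filter m).
- exact: set_algebra_measurable.
- move=> A B mA mB AB; apply: filterS2 (levelA A mA) (levelA B mB).
  by move=> g [bg gA] [_ gB]; have [[+ _] _] := mP _ bg; exact.
- move=> A e mA e0; apply: filterS (levelA A mA) => g [bg gA].
  by have [[_ /(_ A gA)]] := mP _ bg; lra.
- move=> e e0; apply: filterS (levelA setT measurableT) => g [bg _].
  by have [_] := mP _ bg; lra.
Qed.

End existence.

(** * Continuity of a minimal solution *)

Section continuity.
Context {d : measure_display} {T : algebraOfSetsType d} {R : realType}.
Implicit Types (phi lam : set T -> R) (p : R).

Lemma minimal_dominating_continuous phi lam p :
  0 < p -> upper_estimate p phi ->
  minimal_dominating phi measurable lam -> setfun_continuous phi lam.
Proof.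
move=> p0 phi_upper [[lamadd lamge] lammin] A mA phiA.
have aM : set_algebra (@measurable d T) by exact: set_algebra_measurable.
have phi_ge0 B : measurable B -> 0 <= phi B.
  move=> mB; have [<- phi_le] := phi_upper.1.
  by apply: phi_le => //; exact: measurable0.
have lam_ge0 B : measurable B -> 0 <= lam B.
  by move=> mB; apply: le_trans (phi_ge0 _ mB) (lamge _ mB).
apply: contrapT => ncvg.
have [e e0 freq] : exists2 e, 0 < e & ~ (\forall n \near \oo, lam (A n) < e).
  apply: contrapT => h; apply: ncvg; apply/cvgr0Pnorm_lt => e e0.
  apply: contrapT => he; apply: h; exists e => // hn; apply: he.
  by apply: filterS hn => n; rewrite ger0_norm// lam_ge0.
pose F := within [set n | e <= lam (A n)] \oo.
have FF : ProperFilter F.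
  apply: Build_ProperFilter.
  move=> F0; apply: freq; move: F0; rewrite /F /within/=; apply: filterS => n nF.
  by rewrite ltNge; apply/negP => /nF.
have oo_F (P : set nat) : (\forall n \near \oo, P n) -> \forall n \near F, P n.
  by apply: filterS => n Pn _.
have [|||mu dmu] := @dominating_limit _ _ _ _ F
  (fun n B => lam (B `&` ~` A n)) measurable phi (lam setT - e) FF aM.
- move=> B C mB mC BC; apply: oo_F; near=> n.
  by apply: (additive_on_restrict aM lamadd) => //; exact: measurableC.
- move=> B r mB r0; apply: oo_F.
  have lamBA n : 0 <= lam (B `&` ~` A n).
    by apply: lam_ge0; apply: measurableI => //; exact: measurableC.
  have [Br|rB] := leP (phi B) r; first by near=> n; apply: le_trans (lamBA n); lra.
  (* phi B - r <= lam (B `\` A n) once phi (A n)^p is below the gap h. *)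
  have : 0 < phi B `^ p - (phi B - r) `^ p.
    rewrite subr_gt0; apply: (gt0_ltr_powR p0); rewrite ?nnegrE; lra.
  set h := _ - _ => h0.
  have : 0 < h `^ p^-1 by exact: powR_gt0.
  move/cvgr0Pnorm_lt : phiA => /[apply]; apply: filterS => n.
  rewrite ger0_norm ?phi_ge0// => phi_small.
  have mBA : measurable (B `&` A n) by exact: measurableI.
  have mBCA : measurable (B `&` ~` A n).
    by apply: measurableI => //; exact: measurableC.
  have [_ [_ phi_p]] := phi_upper.
  have := phi_p _ _ mBCA mBA.
  rewrite setIACA setICl setI0 -setIUr setUC setUv setIT => /(_ erefl) phiB.
  have phiBA : phi (B `&` A n) `^ p < h.
    have -> : h = (h `^ p^-1) `^ p.
      by rewrite -powRrM mulVf ?lt0r_neq0// powRr1// ltW.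
    apply: (gt0_ltr_powR p0); rewrite ?nnegrE ?phi_ge0 ?powR_ge0//.
    apply: le_lt_trans phi_small; apply: phi_upper.1.2 => //.
  have phiBCA : phi (B `&` ~` A n) `^ p <= lam (B `&` ~` A n) `^ p.
    by apply: (ge0_ler_powR (ltW p0)); rewrite ?nnegrE ?phi_ge0 ?lamge.
  rewrite leNgt; apply/negP => lt.
  have : lam (B `&` ~` A n) `^ p < (phi B - r) `^ p.
    by apply: (gt0_ltr_powR p0); rewrite ?nnegrE ?lamBA//; lra.
  by rewrite /h in phiBA; lra.
- move=> r r0.
  suff : \forall n \near F, e <= lam (A n).
    apply: filterS => n; rewrite setTI => le.
    have := additive_onID aM lamadd measurableT (mA n).
    by rewrite setTD setTI; lra.
  by near=> n; near: n; exact: withinT.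
by move=> mu_lt; have := lammin _ dmu; lra.
Unshelve. all: by end_near. Qed.

End continuity.

Theorem theorem2p2 (d : measure_display) (T : algebraOfSetsType d)
    (R : realType) (p : R) (phi : set T -> R)
    (hp0 : 0 < p) (hp1 : p < 1)
    (hnorm : normalized phi)
    (hsuper : supermeasure phi)
    (hupper : upper_estimate p phi) :
  exists lambda : set T -> R,
    [/\ fa_measure lambda,
        setfun_continuous phi lambda,
        (forall A : set T, measurable A -> phi A <= lambda A)
      & lambda setT <= Kconst p].
Proof.
have [lam0 dom0 lam0K] := dominating_measurable hp0 hp1 hnorm hsuper hupper.
have aM : set_algebra (@measurable d T) by exact: set_algebra_measurable.
have [lam lam_min] := minimal_dominating_exists aM dom0.
have [[lamadd lamge] lammin] := lam_min.
have lam_mono : monotone_setfun lam.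
  split; first exact: additive_on0 aM lamadd.
  move=> A B mA mB AB; rewrite (additive_onID aM lamadd mB mA) (setIidr AB) lerDr.
  have mBA := measurableD mB mA; apply: le_trans (lamge _ mBA).
  have [<- phi_le] := hsuper.1.
  by apply: phi_le => //; exact: measurable0.
exists lam; split=> //.
- by split; split=> // A B mA mB AB; rewrite lamadd.
- exact: minimal_dominating_continuous hp0 hupper lam_min.
- exact: le_trans (lammin _ dom0) lam0K.
Qed.
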